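(* Let $G$ be an infinite group, let $n \geq 1$, and let $G = A_1 \cup \ldots \cup A_n$ be a decomposition of $G$. Then there exist an $i \in \{1,\ldots,n\}$ and a subset $F$ of $G$ such that $|F| \leq 2^{2^{n-1}-1}$ and $F\Delta(A_i) = G$.
   Context: For a subset $A$ of an infinite group $G$, $\Delta(A) = \{g \in G : |gA \cap A| = \infty\}$, where $gA = \{ga : a \in A\}$. For subsets $F, A$ of $G$, $FA = \{fa : f \in F, a \in A\}$. *)

(* Defs.v *)
From mathcomp Require Import all_boot.
From mathcomp Require Import boolp classical_sets functions cardinality.

Set Implicit Arguments.
Unset Strict Implicit.
Unset Printing Implicit Defensive.

Local Open Scope classical_set_scope.

(* [groupType] (boot/monoid.v) is the structure of arbitrary, possibly
   infinite, multiplicatively written groups. *)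

Definition translate (G : groupType) (g : G) (A : set G) : set G :=
  [set (g * a)%g | a in A].

Definition setprod (G : groupType) (F A : set G) : set G :=
  [set (f * a)%g | f in F & a in A].

Definition Delta (G : groupType) (A : set G) : set G :=
  [set g : G | infinite_set (translate g A `&` A)].

(* Main.v *)
Require Import Defs.
From mathcomp Require Import all_boot.
From mathcomp Require Import boolp classical_sets functions cardinality.

(** Call a finite list [T] a window that escapes [B] if only finitely many [x]
    satisfy [T x <= B]. Since [G] is infinite, no window escapes [G] itself.
    Suppose that every cell [A_i] fails, i.e. that [G] is not covered by at
    most [m] translates of [Delta (A_i)]. Then windows escaping ever larger
    unions of cells can be built by induction on the number of cells, which
    ends in a contradiction once all the cells are included.

    The induction step ([escaping_window]) is as follows. Let [B] be the union
    of the cells indexed by [I] and, for [i] in [I], let [T_i] be a window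
    escaping the union of the other cells of [I]. As the translates of
    [Delta (A_i)] by the inverses of [T_i] do not cover [G], some [x_i] makes
    [t x_i A_i] almost disjoint from [A_i] for every [t] in [T_i]. The window
    made of [1] and of all the [T_i x_i] escapes [B]: if it carries [y] into
    [B], then [y] lies in some [A_i], so, up to finitely many [y], the set
    [T_i x_i y] misses [A_i]; it therefore lies in the union of the other
    cells, which again happens for finitely many [y] only.

    The window for [k] cells has size at most [window_bound k], where
    [window_bound k.+1 = 1 + k.+1 * window_bound k], and the step to [n] cells
    uses [m >= window_bound n.-1]. The bound in the theorem follows because
    [window_bound k <= 2 ^ (2 ^ k - 1)]. *)

Local Open Scope classical_set_scope.
Local Open Scope card_scope.

Fixpoint window_bound (k : nat) : nat :=
  if k is k'.+1 then (k * window_bound k').+1 else 1.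

Lemma window_bound_gt k : k < window_bound k.
Proof.
elim: k => [//|k IHk] /=.
by rewrite ltnS leq_pmulr // (leq_trans _ IHk).
Qed.

Lemma leq_window_bound {k l} : k <= l -> window_bound k <= window_bound l.
Proof.
move=> /subnK <-; elim: (l - k) => [//|d IHd].
by rewrite addSn (leq_trans IHd) //= leqW // leq_pmull.
Qed.

(** The right-hand side [f k] satisfies [f k.+1 = 2 * f k ^ 2], which dominates
    [1 + k.+1 * f k] because [f k > k]. *)
Lemma window_bound_le k : window_bound k <= 2 ^ (2 ^ k - 1).
Proof.
elim: k => [//|k IHk] /=; set f := 2 ^ (2 ^ k - 1) in IHk *.
have ltkf : k < f by apply: leq_trans (window_bound_gt k) IHk.
have -> : 2 ^ (2 ^ k.+1 - 1) = f * f + f * f.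
  rewrite addnn -mul2n -expnD -expnS expnS mul2n -addnn.
  have : 0 < 2 ^ k by rewrite expn_gt0.
  by case: (2 ^ k) => // p _; rewrite !subn1 addSn addnS.
rewrite -addn1 leq_add //; first exact: leq_mul.
by rewrite muln_gt0 andbb (leq_trans _ ltkf).
Qed.

Lemma card_seq_le (T : choiceType) (s : seq T) : [set` s] #<= `I_(size s).
Proof.
case: s => [|x0 s]; first by rewrite set_nil card_ge0.
apply: card_le_trans (card_image_le (nth x0 (x0 :: s)) `I_(size (x0 :: s))).
by apply: subset_card_le => x /= /(nthP x0) [i]; exists i.
Qed.

Lemma leq_size_flatten (T : Type) (m : nat) (ss : seq (seq T)) :
  all (fun s => size s <= m) ss -> size (flatten ss) <= size ss * m.
Proof.
elim: ss => [//|s ss IHss] /= /andP[sm ssm].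
by rewrite size_cat mulSn leq_add // IHss.
Qed.

(** Otherwise the inverses of the list would give a set [F] with
    [F Delta(A) = G]. *)
Lemma uncovered_point (G : groupType) (A : set G) (m : nat) :
  (forall F : set G, F #<= `I_m -> setprod F (Delta A) <> [set: G]) ->
  forall T : seq G, size T <= m ->
  exists x : G, forall t, t \in T -> ~ Delta A (t * x)%g.
Proof.
move=> nocover T Tm; apply: contrapT => /forallNP hT.
apply: (nocover [set` [seq t^-1%g | t <- T]]).
  apply: card_le_trans (card_seq_le _ _) _.
  by rewrite size_map card_le_II.
apply/seteqP; split=> // x _.
have /existsNP [t /not_implyP [tT /contrapT Dtx]] := hT x.
exists t^-1%g; first by rewrite /= map_f.
by exists (t * x)%g => //; rewrite mulKg.
Qed.

Definition window_in {G : groupType} (B : set G) (T : seq G) : set G :=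
  [set x | forall t, t \in T -> B (t * x)%g].

Lemma finite_preimage_mulg (G : groupType) (g : G) (B : set G) :
  finite_set B -> finite_set [set x | B (g * x)%g].
Proof.
move=> finB; apply: (@finite_preimage _ _ _ (fun x => g * x)%g) => //.
by move=> x y _ _; apply: mulgI.
Qed.

(** The failure hypothesis is only applied to the windows of proper
    subfamilies of [I], hence the predecessor in [window_bound k.-1 <= m]. *)
Lemma escaping_window (G : groupType) (J : finType) (A : J -> set G)
    (m k : nat) :
  (forall i (T : seq G), size T <= m ->
     exists x : G, forall t, t \in T -> ~ Delta (A i) (t * x)%g) ->
  window_bound k.-1 <= m ->
  forall I : {set J}, #|I| = k ->
  exists2 T : seq G, size T <= window_bound k &
    finite_set (window_in (\bigcup_(i in [set` I]) A i) T).
Proof.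
move=> uncov; elim: k => [_ I /cards0_eq ->|k IHk /= km I cardI].
  exists [:: 1%g] => //; apply: sub_finite_set (finite_set0 G).
  by move=> x /(_ 1%g); rewrite mem_head => /(_ isT) [i]; rewrite /= inE.
have {}IHk := IHk (leq_trans (leq_window_bound (leq_pred k)) km).
have /choice [p hp] : forall i, exists p : seq G * G, i \in I ->
    [/\ size p.1 <= window_bound k,
      finite_set (window_in (\bigcup_(j in [set` I :\ i]) A j) p.1)
    & forall t, t \in p.1 -> ~ Delta (A i) (t * p.2)%g].
  move=> i; have [iI|_] := boolP (i \in I); last by exists ([::], 1%g).
  have cardIi : #|I :\ i| = k by move: cardI; rewrite (cardsD1 i) iI => -[].
  have [T sT finT] := IHk _ cardIi.
  have [x hx] := uncov i T (leq_trans sT km).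
  by exists (T, x).
(* [p i] is the pair [(T_i, x_i)], and [W i] is [T_i x_i]; adding [1] is what
   forces a point carried into the union to lie in some cell. *)
pose W i := [seq (t * (p i).2)%g | t <- (p i).1].
exists (1%g :: flatten [seq W i | i <- enum I]).
  rewrite /= ltnS -cardI cardE -(size_map W) leq_size_flatten //.
  apply/allP => w /mapP [i iI ->]; rewrite mem_enum in iI.
  by rewrite size_map; have [] := hp i iI.
(* The finitely many exceptional [y] for the cell containing [y]: those that
   [T_i x_i] carries into the other cells, and those that it carries back into
   [A_i]. *)
pose E i :=
  [set y | window_in (\bigcup_(j in [set` I :\ i]) A j) (p i).1
             ((p i).2 * y)%g] `|`
  \bigcup_(t in [set` (p i).1])
     [set y | (translate (t * (p i).2)%g (A i) `&` A i) (t * (p i).2 * y)%g].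
apply: (@sub_finite_set _ _ (\bigcup_(i in [set` I]) E i)); last first.
  apply: bigcup_finite; first exact: finite_finset.
  move=> i /= iI; have [_ finT ndelta] := hp i iI.
  rewrite finite_setU; split; first exact: finite_preimage_mulg.
  apply: bigcup_finite => [|t tT]; first exact: finite_seq.
  by apply: finite_preimage_mulg; apply: contrapT; apply: ndelta.
move=> y yW.
have [i /= iI Aiy] : (\bigcup_(i in [set` I]) A i) y.
  by rewrite -[y]mul1g; apply: yW; rewrite mem_head.
exists i => //.
have [[t tT Aity]|noreturn] :=
  pselect (exists2 t, t \in (p i).1 & A i (t * (p i).2 * y)%g).
  by right; exists t => //; split=> //; exists y.
left=> t tT; rewrite mulgA.
have [|j /= jI Ajty] := yW (t * (p i).2)%g.
  rewrite inE; apply/orP; right; apply/flattenP; exists (W i).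
    by rewrite map_f // mem_enum.
  by rewrite (map_f (fun t => t * _)%g).
exists j => //=; rewrite !inE; apply/andP; split=> //.
by apply/eqP => ji; apply: noreturn; exists t; rewrite // ji in Ajty *.
Qed.

Theorem corollary10 (G : groupType) (hG : infinite_set [set: G])
    (n : nat) (hn : (1 <= n)%N) (A : 'I_n -> set G)
    (hA : [set: G] = \bigcup_(i in [set: 'I_n]) A i) :
  exists (i : 'I_n) (F : set G),
    (F #<= `I_(2 ^ (2 ^ (n - 1) - 1))) /\ setprod F (Delta (A i)) = [set: G].
Proof.
apply: contrapT => /forallNP nocover; apply: hG.
have uncov i := @uncovered_point G (A i) (2 ^ (2 ^ (n - 1) - 1))
  (fun F cF FA => nocover i (ex_intro _ F (conj cF FA))).
have bound : window_bound n.-1 <= 2 ^ (2 ^ (n - 1) - 1).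
  by rewrite (subn1 n) window_bound_le.
have cardT : #|[set: 'I_n]%SET| = n by rewrite cardsT card_ord.
have [T _] := @escaping_window G _ A _ n uncov bound _ cardT.
apply: sub_finite_set => x _ t _.
have [i _ Ai] : (\bigcup_(i in [set: 'I_n]) A i) (t * x)%g by rewrite -hA.
by exists i; rewrite //= inE.
Qed.
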